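(* Consider Algorithm 3 (described in the context) run on an M2VPI system $(G,c,\gamma)$. In each phase $k$ of Algorithm 3, the look-ahead Newton–Dinkelbach method invoked in that phase terminates in $O(|E(G^{(k)})|)$ iterations.
   Context: An M2VPI system is given by a directed multigraph $G=(V,E)$, $n=|V|$, $m=|E|$, arc costs $c\in\mathbb{R}^E$ and gain factors $\gamma\in\mathbb{R}^E_{>0}$; each arc $e=(v,w)$ encodes the constraint $y_v-\gamma_e y_w\le c_e$. $\delta^+(v)$, $\delta^-(v)$ denote outgoing/incoming arcs. For a walk $P$ with arcs $e_1,\dots,e_k$: $c(P):=\sum_{i=1}^k(\prod_{j<i}\gamma_{e_j})c_{e_i}$, $\gamma(P):=\prod_i\gamma_{e_i}$ (trivial walk: $c=0,\gamma=1$). A cycle at $u$ is a $u$-$u$ walk with distinct intermediate nodes; it is flow-absorbing if $\gamma(C)<1$. An arc $(v,w)$ is violated w.r.t. labels $y$ if $y_v>c_{vw}+\gamma_{vw}y_w$. Grapevine$(H,y,s)$: for a graph $H$ with costs/gains, labels $y$ (values in $\mathbb{R}\cup\{+\infty\}$) and node $s$: for rounds $i=1,\dots,n$, every node $v$ simultaneously computes $y'_v:=\min(y_v,\min_{vw\in\delta^+(v)}c_{vw}+\gamma_{vw}y_w)$, records $\mathrm{pred}(v,i)$ as a minimizing arc if $y'_v<y_v$ (else none), and then $y:=y'$. A walk $P$ from $s$ is traced by following recorded arcs in reverse chronological order starting from $\mathrm{pred}(s,n)$ (if $\mathrm{pred}(v,i)$ is none, $\mathrm{pred}(v,i-1)$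 is read). It returns $(y,P)$. For a node $u$ and a subgraph $H$, let $H_u$ be obtained by splitting $u$ into $u$ (keeping its outgoing arcs) and a new sink $u'$ receiving all arcs of $H$ entering $u$ (with the same costs and gains). Algorithm 3: initialize $y_v:=\infty$ for all $v$ and $G^{(0)}:=(V,\emptyset)$. Process the nodes $u\in V$ one by one; phase $k$: $G^{(k)}:=G^{(k-1)}\cup\delta^+(u)$ (outgoing arcs of $u$ in $G$); $y_u:=\min_{uv\in\delta^+(u)}c_{uv}+\gamma_{uv}y_v$; if $y_u=\infty$ and $G^{(k)}$ has a flow-absorbing cycle $C$ at $u$, set $y_u:=c(C)/(1-\gamma(C))$. If $y_u<\infty$: define $\bar y$ on $V\cup\{u'\}$ by $\bar y_{u'}:=y_u$, $\bar y_v:=y_v$; run $(\bar y,P):=$Grapevine$(G^{(k)}_u,\bar y,u)$; if some arc of $G^{(k)}_u$ is violated w.r.t. $\bar y$, or $P$ has at least one arc and $\gamma(P)\ge1$, return INFEASIBLE. Otherwise run the look-ahead Newton–Dinkelbach method on $f(\delta):=\inf_{x\in\mathcal{D}}\big(c^\top x+\delta\sum_{e\in\delta^-(u)}\gamma_ex_e-\delta\big)$, where $\mathcal{D}:=\{x\in\mathbb{R}^{E(G^{(k)})}_{\ge0}: x(\delta^+(u))=1,\ \nabla x_v=0\ \forall v\ne u\}$ and $\nabla x_v:=\sum_{e\in\delta^+(v)}x_e-\sum_{e\in\delta^-(v)}\gamma_ex_e$ (in $G^{(k)}$), with initial point $\bar y_{u'}$ and supergradient $\gamma(P)-1$; the value/supergradient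 oracle at $\delta$ sets $\bar y_{u'}:=\delta$ and runs Grapevine$(G^{(k)}_u,\bar y,u)$ (updating $\bar y$); then $f(\delta)=-\infty$ if an arc is violated, otherwise $f(\delta)=\bar y_u-\delta$ with supergradient $\gamma(P)-1$ if the returned walk $P$ ends at $u'$ and $-1$ otherwise. If the method returns NO ROOT, return INFEASIBLE; else set $y:=\bar y|_V$. After all phases return $y$. Look-ahead Newton–Dinkelbach method: from $(\delta^{(i)},g^{(i)})$ with $f(\delta^{(i)})\le0,g^{(i)}<0$: stop with $\delta^{(i)}$ if $f(\delta^{(i)})=0$; else $\delta:=\delta^{(i)}-f(\delta^{(i)})/g^{(i)}$, $g\in\partial f(\delta)$; return NO ROOT if $f(\delta)=-\infty$ or ($f(\delta)<0$ and $g\ge0$); $\delta':=2\delta-\delta^{(i)}$, $g'\in\partial f(\delta')$, and if $-\infty<f(\delta')<0$, $g'<0$ use $(\delta',g')$ instead; set $(\delta^{(i+1)},g^{(i+1)}):=(\delta,g)$. *)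

(* Defs.v *)
From HB Require Import structures.
From mathcomp Require Import all_boot all_order all_algebra.
From mathcomp Require Import reals.
Set Implicit Arguments. Unset Strict Implicit. Unset Printing Implicit Defensive.
Import Order.TTheory GRing.Theory Num.Theory.

Section M2VPI.
Local Open Scope ring_scope.

(* An M2VPI system: nodes V, arcs E (multigraph), arc e = (src e, tgt e),
   cost c e, gain gam e; encodes  y_(src e) - gam e * y_(tgt e) <= c e. *)
Context {R : realType} {V E : finType} (src tgt : E -> V) (c gam : E -> R).

(* ---------- values in R u {+oo}  (None = +oo) ---------- *)
Definition ext := option R.
Definition ext_lt (a b : ext) : bool :=
  match a, b with
  | Some x, Some y => x < y
  | Some _, None => true
  | None, _ => false
  end.
Definition ext_min (a b : ext) : ext := if ext_lt b a then b else a.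
Definition ext_aff (ce ge : R) (y : ext) : ext := omap (fun v => ce + ge * v) y.

(* c(P) = sum_i (prod_(j<i) gam_(e_j)) c_(e_i) *)
Fixpoint wcost (P : seq E) : R :=
  if P is e :: P' then c e + gam e * wcost P' else 0.
Definition wgain (P : seq E) : R := \prod_(e <- P) gam e.

Fixpoint is_walk (A : {set E}) (u v : V) (P : seq E) : bool :=
  if P is e :: P' then [&& e \in A, src e == u & is_walk A (tgt e) v P']
  else u == v.

Definition is_cycle_at (A : {set E}) (u : V) (C : seq E) : bool :=
  let inter := map tgt (take (size C).-1 C) in
  [&& C != [::], is_walk A u u C, uniq inter & u \notin inter].
Definition flow_absorbing_cycle_at (A : {set E}) (u : V) (C : seq E) : bool :=
  is_cycle_at A u C && (wgain C < 1).

(* arcs of G^(k): outgoing arcs of the already processed nodes *)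
Definition Eset (s : seq V) : {set E} := [set e | src e \in s].

(* ---------- the split graph H_u on nodes option V (None = u') ---------- *)
(* arcs of H (arc set A) keep their tail; arcs entering u now enter u'. *)
Definition stgt (u : V) (e : E) : option V :=
  if tgt e == u then None else Some (tgt e).

Definition labels := option V -> ext.

Definition relax (A : {set E}) (u : V) (lab : labels) (v : option V) : ext :=
  \big[ext_min/None]_(e in A | Some (src e) == v)
     ext_aff (c e) (gam e) (lab (stgt u e)).

Definition gv_round (A : {set E}) (u : V) (lab lab' : labels)
    (pr : option V -> option E) : Prop :=
  forall v, lab' v = ext_min (lab v) (relax A u lab v) /\
    (if ext_lt (lab' v) (lab v) then
       exists e, [/\ pr v = Some e, e \in A, Some (src e) = v &
                     lab' v = ext_aff (c e) (gam e) (lab (stgt u e))]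
     else pr v = None).

Fixpoint gv_trace (u : V) (pr : nat -> option V -> option E) (i : nat)
    (v : option V) : seq E :=
  if i is i'.+1 then
    match pr i v with
    | Some e => e :: gv_trace u pr i' (stgt u e)
    | None => gv_trace u pr i' v
    end
  else [::].

(* (labf, P) is a possible result of Grapevine(H_u, lab0, s), H = (V, A);
   n = |V| rounds; any minimizing arc may be recorded. *)
Definition grapevine (A : {set E}) (u : V) (lab0 : labels) (s : option V)
    (labf : labels) (P : seq E) : Prop :=
  exists (ls : nat -> labels) (pr : nat -> option V -> option E),
    [/\ ls 0 =1 lab0,
        (forall i, (i < #|V|)%N -> gv_round A u (ls i) (ls i.+1) (pr i.+1)),
        labf =1 ls #|V| &
        P = gv_trace u pr #|V| s].

Definition violated (A : {set E}) (u : V) (lab : labels) : bool :=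
  [exists e in A,
     ext_lt (ext_aff (c e) (gam e) (lab (stgt u e))) (lab (Some (src e)))].

Definition ends_at_sink (u : V) (P : seq E) : bool :=
  if rev P is e :: _ then stgt u e == None else false.

Definition upd (lab : labels) (d : R) : labels :=
  fun v => if v is Some w then lab (Some w) else Some d.

(* oracle at d, starting from the labels [base]:
   f = None encodes f(d) = -oo. *)
Definition oracle (A : {set E}) (u : V) (base : labels) (d : R)
    (f : option R) (g : R) (lab : labels) : Prop :=
  exists P, grapevine A u (upd base d) (Some u) lab P /\
    (if violated A u lab then f = None
     else (exists a, lab (Some u) = Some a /\ f = Some (a - d)) /\
          g = (if ends_at_sink u P then wgain P - 1 else -1)).

(* iterate: point delta^(i), supergradient g^(i), value f(delta^(i)),
   and the labels computed by the oracle at delta^(i) *)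
Record ndm_state := NS { nd_delta : R; nd_g : R; nd_f : R; nd_lab : labels }.

(* one iteration, from s (assumed f(delta^(i)) <> 0) to s' without NO ROOT *)
Definition ndm_step (A : {set E}) (u : V) (base : labels)
    (s s' : ndm_state) : Prop :=
  let d := nd_delta s - nd_f s / nd_g s in
  exists fd gd ld, oracle A u base d fd gd ld /\
    match fd with
    | None => False
    | Some fdv => ~ (fdv < 0 /\ 0 <= gd) /\
        let d' := 2 * d - nd_delta s in
        exists f' g' l', oracle A u base d' f' g' l' /\
          s' = match f' with
               | Some f'v => if (f'v < 0) && (g' < 0) then NS d' g' f'v l'
                             else NS d gd fdv ld
               | None => NS d gd fdv ld
               end
    end.

(* st 0, ..., st N are the iterates of a run that has performed N
   iterations without stopping (no f = 0 stop, no NO ROOT) *)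
Definition ndm_run (A : {set E}) (u : V) (base : labels) (init : ndm_state)
    (N : nat) (st : nat -> ndm_state) : Prop :=
  st 0 = init /\
  forall i, (i < N)%N -> nd_f (st i) != 0 /\ ndm_step A u base (st i) (st i.+1).

Definition ndm_root (A : {set E}) (u : V) (base : labels) (init : ndm_state)
    (d : R) (lab : labels) : Prop :=
  exists N st, [/\ ndm_run A u base init N st, nd_f (st N) = 0,
                   d = nd_delta (st N) & lab = nd_lab (st N)].

Definition phase_yu (A : {set E}) (u : V) (y : V -> ext) (yu : ext) : Prop :=
  let yu0 := \big[ext_min/None]_(e in A | src e == u)
               ext_aff (c e) (gam e) (y (tgt e)) in
  if yu0 is Some _ then yu = yu0
  else (exists C, flow_absorbing_cycle_at A u C /\
                  yu = Some (wcost C / (1 - wgain C)))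
       \/ ((forall C, ~~ flow_absorbing_cycle_at A u C) /\ yu = None).

Definition ybar (u : V) (y : V -> ext) (d0 : R) : labels :=
  fun v => match v with
           | None => Some d0
           | Some w => if w == u then Some d0 else y w
           end.

(* in the phase of u starting from labels y, the look-ahead N-D method is
   invoked with initial iterate init (its base labels are nd_lab init) *)
Definition ndm_invoked (A : {set E}) (u : V) (y : V -> ext)
    (init : ndm_state) : Prop :=
  exists d0 a0 P,
    [/\ phase_yu A u y (Some d0),
        grapevine A u (ybar u y d0) (Some u) (nd_lab init) P,
        ~~ violated A u (nd_lab init),
        ~~ ((P != [::]) && (1 <= wgain P)) &
        [/\ nd_lab init None = Some (nd_delta init),
            nd_lab init (Some u) = Some a0,
            nd_f init = a0 - nd_delta init &
            nd_g init = wgain P - 1]].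

(* the phase of u ends (without INFEASIBLE) with labels y' *)
Definition phase_next (A : {set E}) (u : V) (y y' : V -> ext) : Prop :=
  (phase_yu A u y None /\ y' =1 (fun w => if w == u then None else y w))
  \/ exists init d lab,
       [/\ ndm_invoked A u y init,
           ndm_root A u (nd_lab init) init d lab &
           y' =1 (fun w => lab (Some w))].

(* reach pre y : after processing the nodes of pre (in this order), Algorithm 3
   can be in state y (not having returned INFEASIBLE) *)
Inductive reach : seq V -> (V -> ext) -> Prop :=
| reach0 : reach [::] (fun _ => None)
| reachS pre u y y' :
    reach pre y -> phase_next (Eset (rcons pre u)) u y y' ->
    reach (rcons pre u) y'.

End M2VPI.

(* Main.v *)
Require Import Defs.
From HB Require Import structures.
From mathcomp Require Import all_boot all_order all_algebra.
From mathcomp Require Import reals.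
From mathcomp Require Import ring lra zify.
Import Order.TTheory GRing.Theory Num.Theory.
Local Open Scope ring_scope.
Set Implicit Arguments. Unset Strict Implicit. Unset Printing Implicit Defensive.

(** Along a run let P_i be the walk from u to the sink u' that is tight at the
    i-th iterate delta_i, and take the reduced costs c*_e >= 0 with respect to the
    labels of the last iterate delta_M that is not a root.  Telescoping,
    the sum over e in P_i of (gain of the part of P_i before e) * c*_e equals
    h_i - f(delta_M), where h_i is the value at delta_M of the tangent at delta_i.
    The look-ahead makes h_i halve every two iterations, and h_i dominates
    -f(delta_M), which also covers the case of an f without a root.  The gain of the
    prefix before a fixed arc never decreases over the iterations.  Hence an arc e
    occurring for the last time in iteration l(e) contributes to each h_i with
    i <= l(e) at most 2 h_(l(e)); dividing by h_i and summing over i and e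
    bounds the number of iterations by a constant times the number of arcs. *)

(** * Amortised counting with geometrically decaying weights *)

Section GeometricCounting.
Context {R : realFieldType}.

(** Induction in steps of two: the last two terms cost at most [2 / h l], and the earlier ones at
    most half of the bound for [l]. The factor 4 solves [x = 2 + x / 2]. *)
Lemma sum_recip_le (h : nat -> R) (K : nat) :
  (forall i, (i < K)%N -> 0 < h i) ->
  (forall i, (i.+1 < K)%N -> h i.+1 <= h i) ->
  (forall i, (i.+2 < K)%N -> 2 * h i.+2 <= h i) ->
  forall l, (l < K)%N -> \sum_(i < l.+1) (h i)^-1 <= 4 * (h l)^-1.
Proof.
move=> hpos hdec hhalf l.
have step i : (i.+1 < K)%N -> (h i)^-1 <= (h i.+1)^-1.
  by move=> iK; rewrite lef_pV2 ?hdec// posrE hpos// ltnW.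
have [m] := ubnP l; elim: m l => // m IH [|[|l]] lm lK.
- by rewrite big_ord1; have := hpos 0 lK; rewrite -invr_gt0; lra.
- rewrite big_ord_recr big_ord1 /=; have := step 0 lK.
  by have := hpos 1 lK; rewrite -invr_gt0; lra.
- rewrite 2!big_ord_recr /=.
  have lK' : (l < K)%N by rewrite ltnW// ltnW.
  have IHl := IH l (ltnW lm) lK'.
  have := step l.+1 lK => s2.
  have h2 := hpos _ lK; have h0 := hpos _ lK'.
  have : 2 * (h l)^-1 <= (h l.+2)^-1.
    rewrite -[2]invrK -invfM lef_pV2 ?posrE// ?mulr_gt0 ?invr_gt0//.
    by have := hhalf l lK; lra.
  by move: IHl s2; lra.
Qed.

(* Charge step i to the arcs of P i, each weighed at its last occurrence: since
   the weights of a surviving arc grow while h decays geometrically, every arc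
   is charged a bounded geometric series in total. *)
Lemma geometric_counting (E : finType) (A : {set E}) (K : nat)
    (P : nat -> seq E) (w : nat -> E -> R) (h : nat -> R) :
  (forall i, (i < K)%N -> 0 < h i) ->
  (forall i, (i.+1 < K)%N -> h i.+1 <= h i) ->
  (forall i, (i.+2 < K)%N -> 2 * h i.+2 <= h i) ->
  (forall i, (i < K)%N -> {subset P i <= A}) ->
  (forall i e, (i < K)%N -> e \in P i -> 0 <= w i e) ->
  (forall i, (i < K)%N -> h i <= \sum_(e in P i) w i e <= 2 * h i) ->
  (forall i j e, (i < j < K)%N -> e \in P i -> e \in P j -> w i e <= w j e) ->
  (K <= 8 * #|A|)%N.
Proof.
move=> hpos hdec hhalf PA w0 hw wmono.
pose l e := \max_(j < K | e \in P j) j.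
have lP i e : (i < K)%N -> e \in P i ->
    [/\ (i <= l e)%N, (l e < K)%N & e \in P (l e)].
  move=> iK ePi.
  have il : (i <= l e)%N.
    exact: (@leq_bigmax_cond _ (fun j : 'I_K => e \in P j) _ (Ordinal iK)).
  have [|j je jE] :=
    @eq_bigmax_cond _ [pred j : 'I_K | e \in P j] (fun j : 'I_K => (j : nat)).
    by apply/card_gt0P; exists (Ordinal iK).
  by move: il; rewrite /l jE; split => //; move: je; rewrite inE.
(* After division by [h i] every iteration carries charge at least 1. Exchanging the sums then
   leaves at most [2 * 4] per arc. *)
have step i : (i < K)%N ->
    1 <= \sum_(e in A | e \in P i) 2 * h (l e) * (h i)^-1.
  move=> iK; rewrite -mulr_suml ler_pdivlMr ?hpos// mul1r.
  have /andP[+ _] := hw i iK; move/le_trans; apply.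
  rewrite [leRHS](eq_bigl (mem (P i))); last first.
    by move=> e /=; rewrite andb_idl// => /(PA _ iK).
  apply: ler_sum => e ePi; have [il lK ePl] := lP _ _ iK ePi.
  have wl : w i e <= w (l e) e.
    by move: il; rewrite leq_eqVlt => /predU1P[<-//|il]; apply: wmono => //; rewrite il.
  apply: le_trans wl _; have /andP[_] := hw _ lK; apply: le_trans.
  rewrite (bigD1 e)//= lerDl sumr_ge0// => e' /andP[e'P _]; exact: w0.
suff : (K%:R : R) <= (8 * #|A|)%:R by rewrite ler_nat.
have -> : (K%:R : R) = \sum_(i < K) 1 by rewrite sumr_const card_ord.
have -> : ((8 * #|A|)%:R : R) = \sum_(e in A) 8 by rewrite sumr_const natrM mulr_natr.
apply: (@le_trans _ _ (\sum_(i < K) \sum_(e in A | e \in P i) 2 * h (l e) * (h i)^-1)).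
  by apply: ler_sum => i _; apply: step.
rewrite (exchange_big_dep (mem A)) /=; last by move=> i e _ /andP[].
apply: ler_sum => e eA.
have [/existsP[i0 ePi0]|] := boolP [exists i : 'I_K, e \in P i]; last first.
  by move=> /existsPn eP; rewrite big1// => i /andP[_]; rewrite (negbTE (eP i)).
have [_ lK _] := lP _ _ (ltn_ord i0) ePi0.
have hl := hpos _ lK.
rewrite -mulr_sumr.
have le4 : \sum_(i < K | (e \in A) && (e \in P i)) (h i)^-1 <= 4 * (h (l e))^-1.
  apply: le_trans (sum_recip_le hpos hdec hhalf lK).
  rewrite (big_ord_widen_cond K predT (fun i => (h i)^-1)) //.
  rewrite big_mkcond [leRHS]big_mkcond /=; apply: ler_sum => i _.
  case: ifP => [/andP[_ ePi]|_].
    by have [il _ _] := lP _ _ (ltn_ord i) ePi; rewrite ltnS il.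
  by case: ifP => // _; rewrite invr_ge0 ltW// hpos.
apply: le_trans (ler_wpM2l _ le4) _; first by rewrite mulr_ge0// ltW.
by rewrite mulrACA divff ?gt_eqF// mulr1; lra.
Qed.

End GeometricCounting.

(** * Newton's method with look-ahead on a concave function *)

Section LookAheadNewton.
Context {R : realFieldType}.
Context (M : nat) (f g dl : nat -> R).
Let newton i := dl i - f i / g i.

Hypothesis f_lt0 : forall i, (i <= M)%N -> f i < 0.
Hypothesis g_lt0 : forall i, (i <= M)%N -> g i < 0.
Hypothesis tangent :
  forall i j, (i <= M)%N -> (j <= M)%N -> f i <= f j + g j * (dl i - dl j).
(** The second alternative is a rejected look-ahead; of the rejected point only its position
    relative to the last iterate is recorded. *)
Hypothesis step : forall i, (i < M)%N ->
  dl i.+1 = 2 * newton i - dl i \/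
  dl i.+1 = newton i /\ 2 * newton i - dl i <= dl M.

Definition tangent_at_last i := f i + g i * (dl M - dl i).

Let f_newton i : (i <= M)%N -> f i = g i * (dl i - newton i).
Proof. by move=> iM; rewrite /newton subKr mulrC divfK// lt_eqF// g_lt0. Qed.

Let newton_lt i : (i <= M)%N -> newton i < dl i.
Proof.
move=> iM; have := f_newton iM; have := f_lt0 iM; have := g_lt0 iM.
by move: (newton i) => v; nra.
Qed.

Let delta_le_newton i : (i < M)%N -> dl i.+1 <= newton i.
Proof. by move=> iM; have := newton_lt (ltnW iM); case: (step iM); lra. Qed.

Lemma iterates_decr i j : (i < j <= M)%N -> dl j < dl i.
Proof.
elim: j => // j IH /andP[+ jM]; rewrite ltnS => ij.
have lj : dl j.+1 < dl j.
  exact: le_lt_trans (delta_le_newton jM) (newton_lt (ltnW jM)).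
move: ij; rewrite leq_eqVlt => /predU1P[->//|ij].
by apply: lt_trans lj (IH _); rewrite ij ltnW.
Qed.

Let delta_le i j : (i <= j <= M)%N -> dl j <= dl i.
Proof.
case/andP; rewrite leq_eqVlt => /predU1P[->//|ij] jM.
by rewrite ltW// iterates_decr// ij.
Qed.

Let slope_le i j : (i < j <= M)%N -> g i <= g j.
Proof.
move=> ijM; have dd := iterates_decr ijM; case/andP: ijM => ij jM.
have iM : (i <= M)%N by rewrite ltnW// (leq_trans ij).
by have := tangent iM jM; have := tangent jM iM; nra.
Qed.

Let tangentE i : (i <= M)%N -> tangent_at_last i = g i * (dl M - newton i).
Proof. by move=> iM; rewrite /tangent_at_last {1}f_newton//; ring. Qed.

(** As [f] increases along the iterates, it suffices to bound [- f] at the next-to-last one, [m].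
    Its Newton step runs between [newton i] and [dl M], and the slope at [i] is at least as
    steep. *)
Lemma tangent_at_last_ge i : (i.+2 <= M)%N -> - f M <= tangent_at_last i.
Proof.
move=> iM; pose m := M.-1; have eM : M = m.+1 by rewrite /m prednK// (leq_trans _ iM).
have [mM mM' im] : [/\ (m < M)%N, (m <= M)%N & (i < m)%N] by split; lia.
rewrite tangentE; last by rewrite ltnW// ltnW.
have dm := delta_le_newton mM; have di := delta_le_newton (ltn_trans im mM).
have dd : dl m <= dl i.+1 by apply: delta_le; rewrite im.
rewrite -eM in dm.
have ff : f m <= f M.
  have := tangent mM' (leqnn M); have := g_lt0 (leqnn M).
  by have := @iterates_decr m M; rewrite mM leqnn => /(_ isT); nra.
have gg : g i <= g m by apply: slope_le; rewrite im.
have := f_newton mM'; have := g_lt0 mM'; have := newton_lt mM'.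
move: (newton m) (newton i) dm di => vm vi dm di lm gm fm.
have : 0 <= - g m by lra.
move=> gm0.
apply: (@le_trans _ _ (- g m * (vi - dl M))); last by nra.
apply: (@le_trans _ _ (- f m)); first by lra.
by rewrite fm -mulNr ler_wpM2l//; lra.
Qed.

(** By [tangentE] the quantity is the steepness times the distance from the Newton point to [dl M];
    both factors shrink. *)
Lemma tangent_at_last_decr i : (i.+2 <= M)%N ->
  tangent_at_last i.+1 <= tangent_at_last i.
Proof.
move=> iM; have iM' := ltnW iM; have iM'' := ltnW iM'.
rewrite !tangentE//.
have gg : g i <= g i.+1 by apply: slope_le; rewrite ltnSn.
have n1 := newton_lt iM'; have d1 := delta_le_newton iM'.
have d2 := delta_le_newton iM.
have d3 : dl M <= dl i.+2 by apply: delta_le; rewrite iM leqnn.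
have := g_lt0 iM'; have := g_lt0 iM''.
move: (newton i) (newton i.+1) n1 d1 d2 => v v1 n1 d1 d2 gi gi1.
nra.
Qed.

(* A successful look-ahead halves the slope; two consecutive failures halve the
   distance from the Newton point to the last iterate. *)
Lemma tangent_at_last_halve i : (i.+3 <= M)%N ->
  2 * tangent_at_last i.+2 <= tangent_at_last i.
Proof.
have half k : (k.+2 <= M)%N -> dl k.+1 = 2 * newton k - dl k ->
    2 * tangent_at_last k.+1 <= tangent_at_last k.
  move=> kM dk; have kM' := ltnW kM; have kM'' := ltnW kM'.
  have := tangent kM'' kM'; rewrite !tangentE// [f k]f_newton// [f k.+1]f_newton//.
  have n0 := newton_lt kM''; have n1 := newton_lt kM'.
  have d2 := delta_le_newton kM.
  have d3 : dl M <= dl k.+2 by apply: delta_le; rewrite kM leqnn.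
  have := g_lt0 kM'; have := g_lt0 kM''.
  move: (newton k) (newton k.+1) dk n0 n1 d2 => v v1 dk n0 n1 d2 g0 g1 tt.
  (* [f k] is the slope times one Newton step, whereas the look-ahead moved by two; the tangent at
     [k.+1] compares them. *)
  have gg : g k <= 2 * g k.+1.
    have e : dl k - dl k.+1 = 2 * (dl k - v) by rewrite dk; ring.
    have s0 : 0 < dl k - v by rewrite subr_gt0.
    have p : g k.+1 * (dl k.+1 - v1) <= 0 by nra.
    rewrite -(ler_pM2r s0); rewrite e in tt.
    by nra.
  nra.
move=> iM; have iM1 := ltnW iM; have iM2 := ltnW iM1; have iM3 := ltnW iM2.
case: (step iM2) => [/(half _ iM1)|[e1 l1]].
  by have := tangent_at_last_decr iM; lra.
case: (step iM1) => [/(half _ iM)|[e2 l2]].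
  by have := tangent_at_last_decr iM1; lra.
apply: le_trans (_ : 2 * tangent_at_last i.+1 <= _).
  by have := tangent_at_last_decr iM; lra.
have := tangent iM3 iM2; rewrite !tangentE// [f i]f_newton// [f i.+1]f_newton//.
have n0 := newton_lt iM3; have n1 := newton_lt iM2.
have d3 : dl M <= dl i.+2 by apply: delta_le; rewrite iM1 leqnn.
have := g_lt0 iM2; have := g_lt0 iM3.
move: (newton i) (newton i.+1) e1 l1 e2 l2 n0 n1 d3 => v v1 e1 l1 e2 l2 n0 n1 d3.
(* [a] and [s] are the Newton steps from [i] and [i.+1], and [b] is the distance from the first
   Newton point to [dl M]. The two rejections give [b <= a] and [b <= 2 * s]. *)
pose a := dl i - v; pose b := v - dl M; pose s := v - v1.
have [-> ->] : dl i - dl i.+1 = a /\ dl i.+1 - v1 = s by rewrite /a /s e1.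
have [-> ->] : dl M - v1 = s - b /\ dl M - v = - b by rewrite /b /s; split; ring.
have -> : dl i - v = a by [].
have [a0 s0 b0 ba bs] : [/\ 0 < a, 0 < s, 0 <= b - s, b <= a & b <= 2 * s].
  by rewrite /a /b /s; split; lra.
move: (a) (b) (s) a0 s0 b0 ba bs => {a b s} a b s a0 s0 b0 ba bs g0 g1 tt.
rewrite -(ler_pM2r a0).
have : (- g i.+1) * ((b - s) * a * 2) <= (- g i.+1) * (b * (a + s)).
  by apply: ler_wpM2l; [lra|nra].
nra.
Qed.

End LookAheadNewton.

(** * Order on the reals extended by infinity *)

Section ExtendedReals.
Context {R : realType}.
Implicit Types a b d : @ext R.

Definition ext_le a b := ~~ ext_lt b a.

Lemma ext_le_trans b a d : ext_le a b -> ext_le b d -> ext_le a d.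
Proof. by rewrite /ext_le; case: a b d => [x|] [y|] [z|] //=; rewrite -!leNgt; apply: le_trans. Qed.

Lemma ext_lt_le_trans b a d : ext_lt a b -> ext_le b d -> ext_lt a d.
Proof. by rewrite /ext_le; case: a b d => [x|] [y|] [z|] //=; rewrite -?leNgt; apply: lt_le_trans. Qed.

Lemma ext_le_anti a b : ext_le a b -> ext_le b a -> a = b.
Proof.
rewrite /ext_le; case: a b => [x|] [y|] //=; rewrite -?leNgt => xy yx.
by congr Some; apply/le_anti/andP.
Qed.

Lemma ext_le_refl a : ext_le a a.
Proof. by rewrite /ext_le; case: a => //= x; rewrite ltxx. Qed.

Lemma ext_minl a b : ext_le (ext_min a b) a.
Proof.
rewrite /ext_min /ext_le; case: a b => [x|] [y|] //=; rewrite ?ltxx//.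
by case: (ltP y x) => /= yx; rewrite -leNgt ?lexx// ltW.
Qed.

Lemma ext_minr a b : ext_le (ext_min a b) b.
Proof.
rewrite /ext_min /ext_le; case: a b => [x|] [y|] //=; rewrite ?ltxx//.
by case: (ltP y x) => /= yx; rewrite -leNgt ?lexx.
Qed.

Lemma ext_bigmin_le (I : finType) (P : pred I) (F : I -> @ext R) i :
  P i -> ext_le (\big[ext_min/None]_(j | P j) F j) (F i).
Proof.
move=> Pi; have : i \in index_enum I by rewrite mem_index_enum.
elim: (index_enum I) => // j r IH; rewrite inE big_cons => /predU1P[<-|/IH{}IH].
  by rewrite Pi; apply: ext_minl.
by case: ifP => // _; apply: ext_le_trans IH; apply: ext_minr.
Qed.

Lemma ext_aff_le c g a b : 0 < g -> ext_le a b -> ext_le (ext_aff c g a) (ext_aff c g b).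
Proof.
move=> g0; rewrite /ext_le; case: a b => [x|] [y|] //=; rewrite -!leNgt => xy.
by rewrite lerD2l ler_pM2l.
Qed.

Lemma ext_le_Some a x : ext_le a (Some x) -> exists2 y, a = Some y & y <= x.
Proof. by rewrite /ext_le; case: a => //= y; rewrite -leNgt; exists y. Qed.

End ExtendedReals.

(** * Walks and feasible labels in the split graph *)

Section SplitGraph.
Context {R : realType} {V E : finType} (src tgt : E -> V) (c gam : E -> R).
Hypothesis gam_gt0 : forall e, 0 < gam e.
Context (A : {set E}) (u : V).

Local Notation stgt := (stgt tgt u).
Local Notation wcost := (wcost c gam).
Local Notation wgain := (wgain gam).

Definition arc_ok (lab : labels) (e : E) : bool :=
  ext_le (lab (Some (src e))) (ext_aff (c e) (gam e) (lab (stgt e))).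

Definition feasible (lab : @labels R V) : Prop := forall e, e \in A -> arc_ok lab e.

Lemma feasibleP lab : reflect (feasible lab) (~~ violated src tgt c gam A u lab).
Proof.
apply: (iffP idP) => [/existsPn nv e eA|fe].
  by have := nv e; rewrite eA.
by apply/existsPn => e; apply/negP => /andP[/fe]; rewrite /arc_ok /ext_le => /negbTE->.
Qed.

Fixpoint swalk (x y : option V) (P : seq E) : bool :=
  if P is e :: P' then [&& e \in A, Some (src e) == x & swalk (stgt e) y P'] else x == y.

Lemma swalk_cat x y P Q :
  swalk x y (P ++ Q) <-> exists2 z, swalk x z P & swalk z y Q.
Proof.
elim: P x => [|e P IH] x /=.
  by split=> [|[z /eqP->]//]; exists x.
split=> [/and3P[eA ex /IH[z zP zQ]]|[z /and3P[eA ex zP] zQ]].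
  by exists z => //; rewrite eA ex.
by rewrite eA ex; apply/IH; exists z.
Qed.

Lemma swalk_mem x y P : swalk x y P -> {subset P <= A}.
Proof.
elim: P x => //= e P IH x /and3P[eA _ /IH PA] e'.
by rewrite inE => /predU1P[->|/PA].
Qed.

Lemma wgain_cons e P : wgain (e :: P) = gam e * wgain P.
Proof. by rewrite /wgain big_cons. Qed.

Lemma wgain_nil : wgain [::] = 1.
Proof. by rewrite /wgain big_nil. Qed.

Lemma wgain_cat P Q : wgain (P ++ Q) = wgain P * wgain Q.
Proof. by rewrite /wgain big_cat. Qed.

Lemma wcost_cat P Q : wcost (P ++ Q) = wcost P + wgain P * wcost Q.
Proof.
elim: P => [|e P IH] /=; first by rewrite wgain_nil; ring.
by rewrite IH wgain_cons; ring.
Qed.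

Lemma wgain_gt0 P : 0 < wgain P.
Proof. by apply: prodr_gt0. Qed.

Lemma feasible_walk lab x y P : (forall e, e \in P -> arc_ok lab e) ->
  swalk x y P -> ext_le (lab x) (ext_aff (wcost P) (wgain P) (lab y)).
Proof.
elim: P x => [|e P IH] x ok /=.
  move=> /eqP->; rewrite wgain_nil; case: (lab y) => //= r.
  by rewrite mul1r add0r ext_le_refl.
case/and3P => _ /eqP<- wP.
apply: ext_le_trans (ok _ (mem_head _ _)) _.
have {}IH := IH (stgt e) (fun e' h => ok e' (@mem_behead _ (e :: P) e' h)) wP.
apply: ext_le_trans (ext_aff_le _ (gam_gt0 e) IH) _; rewrite wgain_cons.
by case: (lab y) => //= r; rewrite /ext_le /= -leNgt; lra.
Qed.

Lemma feasible_walk_Some lab x y P r : feasible lab -> swalk x y P ->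
  lab y = Some r -> exists2 q, lab x = Some q & q <= wcost P + wgain P * r.
Proof.
move=> fe wP ly; apply: ext_le_Some.
have -> : Some (wcost P + wgain P * r) = ext_aff (wcost P) (wgain P) (lab y) by rewrite ly.
by apply: (feasible_walk _ wP) => e /(swalk_mem wP) /fe.
Qed.

Lemma swalk_sink x P : P != [::] -> swalk x None P -> ends_at_sink tgt u P.
Proof.
case/lastP: P => // P e _; rewrite /ends_at_sink rev_rcons -cats1.
by move=> /swalk_cat[z _] /= /and3P[].
Qed.

(** * Traces recorded by Grapevine *)

Section Trace.
Context (n : nat) (ls : nat -> @labels R V) (pr : nat -> option V -> option E) (d : R).
Hypothesis rounds : forall i, (i < n)%N ->
  gv_round src tgt c gam A u (ls i) (ls i.+1) (pr i.+1).
Hypothesis sink0 : ls 0 None = Some d.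
(** Arcs into the sink are exempt, since an oracle call resets the sink label. *)
Hypothesis ok0 : forall e, e \in A -> stgt e != None -> arc_ok (ls 0) e.

Lemma round_le i v : (i < n)%N -> ext_le (ls i.+1 v) (ls i v).
Proof. by move=> /rounds/(_ v)[-> _]; apply: ext_minl. Qed.

Lemma rounds_le i j v : (i <= j <= n)%N -> ext_le (ls j v) (ls i v).
Proof.
elim: j => [|j IH]; first by rewrite leqn0 => /andP[/eqP-> _]; apply: ext_le_refl.
case/andP; rewrite leq_eqVlt => /predU1P[->|]; first by move=> _; apply: ext_le_refl.
rewrite ltnS => ij jn; apply: ext_le_trans (round_le _ jn) (IH _).
by rewrite ij ltnW.
Qed.

Lemma round_arc i e : (i < n)%N -> e \in A ->
  ext_le (ls i.+1 (Some (src e))) (ext_aff (c e) (gam e) (ls i (stgt e))).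
Proof.
move=> /rounds/(_ (Some (src e)))[-> _] eA.
apply: ext_le_trans (ext_minr _ _) _; rewrite /relax.
by apply: (@ext_bigmin_le R E _ (fun e => ext_aff (c e) (gam e) (ls i (stgt e)))); rewrite eA eqxx.
Qed.

Lemma sink_fixed i : (i <= n)%N -> ls i None = Some d.
Proof.
elim: i => // i IH iN; have [-> _] := rounds iN None.
by rewrite (IH (ltnW iN)) /relax big_pred0// => e; rewrite andbF.
Qed.

(* A walk of arcs violated in rounds i, i-1, ..., 0 whose improvements feed each
   other; it can only end at the sink, whose arcs alone are violated initially. *)
Fixpoint violation_chain (i : nat) (P : seq E) {struct P} : Prop :=
  if P is e :: P' then
    [/\ e \in A, ~~ arc_ok (ls i) e &
      match i with
      | 0 => P' = [::] /\ stgt e = None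
      | i'.+1 => violation_chain i' P' /\
          exists e' P'', [/\ P' = e' :: P'', stgt e = Some (src e') &
            ls i (stgt e) = ext_aff (c e') (gam e') (ls i' (stgt e'))]
      end]
  else False.

(** Round [i.+1] repairs every arc whose head keeps its label. So if [e] is violated afterwards, its
    head has just improved, along a recorded arc that was violated one round earlier. *)
Lemma trace_chain i e : (i <= n)%N -> e \in A -> ~~ arc_ok (ls i) e ->
  violation_chain i (e :: gv_trace tgt u pr i (stgt e)).
Proof.
elim: i e => [|i IH] e iN eA vio /=; split => //.
  by split => //; apply/eqP; apply: contraNT vio; apply: ok0.
have lt : ext_lt (ls i.+1 (stgt e)) (ls i (stgt e)).
  apply: contraNT vio => ge; have eqs : ls i.+1 (stgt e) = ls i (stgt e).
    exact: ext_le_anti (round_le _ iN) ge.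
  by rewrite /arc_ok eqs; apply: round_arc.
have [_] := rounds iN (stgt e); rewrite lt => -[e' [-> e'A se' le']].
split; last by exists e', (gv_trace tgt u pr i (stgt e')).
apply: IH (ltnW iN) e'A _.
by rewrite /arc_ok /ext_le negbK se' -le'.
Qed.

Lemma chain_size i P : violation_chain i P -> size P = i.+1.
Proof. by elim: i P => [|i IH] [|e P] //= [_ _ []] => [->|/IH->]. Qed.

Lemma chain_walk i e P : violation_chain i (e :: P) ->
  swalk (Some (src e)) None (e :: P) /\
  ext_aff (c e) (gam e) (ls i (stgt e)) = Some (wcost (e :: P) + wgain (e :: P) * d).
Proof.
elim: i e P => [|i IH] e P /= [eA _ []].
  by move=> -> se; rewrite eA eqxx se sink0 /= wgain_cons wgain_nil; split => //; congr Some; ring.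
move=> ch [e' [P' [eP se ls']]]; subst P; have [wP lP] := IH _ _ ch.
rewrite eA eqxx ls' lP; rewrite -se in wP; split => //=.
by congr Some; rewrite !wgain_cons; ring.
Qed.

Lemma chain_suffix i P e Q : violation_chain i (P ++ e :: Q) ->
  violation_chain (i - size P) (e :: Q) /\ i = (size P + size Q)%N.
Proof.
move=> ch; have := chain_size ch; rewrite size_cat /= addnS => -[iE]; split => //.
rewrite -iE addKn; elim: P i ch {iE} => [|e' P IH] i ch.
  by have := chain_size ch => -[->].
case: i ch => [|i] /= [_ _]; first by case=> + _; case: P {IH}.
by case=> /IH.
Qed.

Lemma trace_cases i v : (i <= n)%N ->
  (gv_trace tgt u pr i v = [::] /\ ls i v = ls 0 v) \/
  (exists j e, [/\ (j < i)%N, e \in A, Some (src e) = v, ~~ arc_ok (ls j) e &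
     gv_trace tgt u pr i v = e :: gv_trace tgt u pr j (stgt e) /\
     ls i v = ext_aff (c e) (gam e) (ls j (stgt e))]).
Proof.
elim: i => [|i IH] iN; first by left.
have [lsE] := rounds iN v; case: ifP => [lt [e [pe eA se le]]|ge pe].
  right; exists i, e; rewrite /= pe; split => //.
  by rewrite /arc_ok /ext_le negbK se -le.
have -> : ls i.+1 v = ls i v.
  by apply: ext_le_anti (round_le _ iN) _; rewrite /ext_le ge.
rewrite /= pe; case: (IH (ltnW iN)) => [|[j [e [ji eA se vio tr]]]]; first by left.
by right; exists j, e; split => //; apply: leqW.
Qed.

(* A repeated node would close a cycle along which the labels decrease.  The
   initial labels, which do not violate it, force its gain to exceed one, and
   then no label below the recorded one can be feasible for it. *)
Lemma chain_uniq base lab' d0 d' :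
  (forall v : V, ls 0 (Some v) = base (Some v)) ->
  feasible base -> base None = Some d0 ->
  feasible lab' -> lab' None = Some d' -> d' <= d ->
  forall i P, (i <= n)%N -> violation_chain i P -> uniq (map src P).
Proof.
move=> lsb feb b0 fe' l0 d'd i P; elim: P i => // e P IH i iN ch.
rewrite map_cons cons_uniq; apply/andP; split; last first.
  case: i iN ch => [|i] iN /= [_ _ []]; first by move=> ->.
  by move=> ch _; apply: IH (ltnW iN) ch.
apply/negP => /mapP[e2 e2P se].
case/splitPr: e2P ch IH => P1 P2 ch _.
have [ch2 iE] := chain_suffix (P := e :: P1) ch.
set j := (i - _)%N in ch2.
have ji : (j < i)%N by rewrite /j iE /=; lia.
have [w1 v1] := chain_walk ch; have [w2 v2] := chain_walk ch2.
have /swalk_cat[z wC wQ] := w1 : swalk _ _ ((e :: P1) ++ e2 :: P2).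
have zE : z = Some (src e) by move: wQ => /= /and3P[_ /eqP<- _]; rewrite se.
rewrite zE in wC.
set w := Some (src e) in wC w1.
rewrite -se -/w in w2.
have [b bE _] := feasible_walk_Some feb w2 b0.
have [y yE yle] := feasible_walk_Some fe' w2 l0.
have [b' bE' ble] := feasible_walk_Some feb wC bE.
have [y' yE' yle'] := feasible_walk_Some fe' wC yE.
have {bE'} bb : b' = b by move: bE'; rewrite bE => -[].
have {yE'} yy : y' = y by move: yE'; rewrite yE => -[].
subst b' y'.
rewrite -[e :: _ ++ _]/((e :: P1) ++ e2 :: P2) in v1.
rewrite wcost_cat wgain_cat in v1.
(* [C] is the closed walk at the repeated node and [Q] the rest of the chain up to the sink. *)
set C := e :: P1 in wC v1 ble yle'; set Q := e2 :: P2 in v1 v2 yle w2.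
have [_ vio _] : violation_chain i (e :: (P1 ++ e2 :: P2)) := ch.
have [_ vio2 _] := (ch2 : violation_chain j (e2 :: P2)).
rewrite /arc_ok /ext_le negbK v1 -/w in vio.
rewrite /arc_ok /ext_le negbK v2 -se -/w in vio2.
have jn : (j < n)%N := leq_trans ji iN.
have lt1 : ext_lt (Some (wcost C + wgain C * wcost Q + wgain C * wgain Q * d))
                  (Some (wcost Q + wgain Q * d)).
  rewrite -v2; apply: ext_lt_le_trans vio _.
  apply: ext_le_trans (rounds_le (i := j.+1) _ _) _; first by rewrite ji iN.
  have e2A : e2 \in A by case: ch2.
  by have := round_arc jn e2A; rewrite -se.
have lt2 : ext_lt (Some (wcost Q + wgain Q * d)) (Some b).
  rewrite -bE -lsb; apply: ext_lt_le_trans vio2 _.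
  by apply: rounds_le; rewrite leq0n ltnW.
move: lt1 lt2; rewrite /ext_lt; have := wgain_gt0 Q; have := wgain_gt0 C.
move: (wgain C) (wgain Q) (wcost C) (wcost Q) yle ble yle' => gC gQ cC cQ.
move=> yle ble yle' gC0 gQ0 lt1 lt2.
set z1 := cQ + gQ * d in lt1 lt2.
have yz : y <= z1 by apply: le_trans yle _; rewrite lerD2l ler_pM2l.
have {}lt1 : cC + gC * z1 < z1 by rewrite {1}/z1 mulrDr !mulrA addrA.
(* The map [x |-> cC + gC * x] lies below the identity at [z1] but not at [b > z1], so its slope
   exceeds one; it then stays below the identity at [y <= z1]. *)
have gC1 : 1 < gC by nra.
suff : cC + gC * y < y by rewrite ltNge yle'.
nra.
Qed.

End Trace.

Lemma grapevine_trace lab0 lab P d : grapevine src tgt c gam A u lab0 (Some u) lab P ->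
  lab0 None = Some d ->
  (forall e, e \in A -> stgt e != None -> arc_ok lab0 e) ->
  lab None = Some d /\
  ((P = [::] /\ lab (Some u) = lab0 (Some u)) \/
   [/\ P != [::], swalk (Some u) None P & lab (Some u) = Some (wcost P + wgain P * d)]).
Proof.
case=> ls [pr [ls0 rd lsn ->]] l0 ok.
have s0 : ls 0 None = Some d by rewrite ls0.
have ok0 e : e \in A -> stgt e != None -> arc_ok (ls 0) e.
  by rewrite /arc_ok !ls0; apply: ok.
rewrite !lsn (sink_fixed rd s0)//; split => //.
case: (trace_cases rd (Some u) (leqnn _)) => [[-> ->]|]; first by left; rewrite ls0.
case=> j [e [jn eA se vio [-> ->]]]; right; split => //.
  have [] := chain_walk s0 (trace_chain rd ok0 (ltnW jn) eA vio).
  by rewrite se.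
by have [] := chain_walk s0 (trace_chain rd ok0 (ltnW jn) eA vio).
Qed.

Lemma grapevine_le lab0 lab x P v : grapevine src tgt c gam A u lab0 x lab P ->
  ext_le (lab v) (lab0 v).
Proof.
case=> ls [pr [ls0 rd lsn _]]; rewrite lsn -ls0.
by apply: (rounds_le rd); rewrite leqnn.
Qed.

(** [lab'] certifies that no decreasing cycle can be traced. An arc still violated after [#|V|]
    rounds would yield a chain of [#|V| + 1] arcs with distinct tails. *)
Lemma grapevine_converges base lab' lab P d0 d' d :
  feasible base -> base None = Some d0 ->
  feasible lab' -> lab' None = Some d' -> d' <= d ->
  grapevine src tgt c gam A u (upd base d) (Some u) lab P ->
  feasible lab /\ uniq (map src P).
Proof.
move=> feb b0 fe' l0 d'd [ls [pr [ls0 rd lsn ->]]].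
have s0 : ls 0 None = Some d by rewrite ls0.
have ok0 e : e \in A -> stgt e != None -> arc_ok (ls 0) e.
  by move=> /feb; rewrite /arc_ok !ls0; case: (stgt e).
have lsb v : ls 0 (Some v) = base (Some v) by rewrite ls0.
have un := chain_uniq rd s0 lsb feb b0 fe' l0 d'd.
split; last first.
  case: (trace_cases rd (Some u) (leqnn _)) => [[-> //]|].
  case=> j [e [jn eA se vio [-> _]]].
  exact: un (ltnW jn) (trace_chain rd ok0 (ltnW jn) eA vio).
move=> e eA; suff : arc_ok (ls #|V|) e by rewrite /arc_ok !lsn.
apply: contraT => vio; have ch := trace_chain rd ok0 (leqnn _) eA vio.
have /card_uniqP := un _ _ (leqnn _) ch; rewrite size_map (chain_size ch) => cd.
by have := max_card (mem (map src (e :: gv_trace tgt u pr #|V| (stgt e)))); rewrite cd ltnn.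
Qed.

End SplitGraph.

(** * Iterates of the method within one phase *)

Section Iterations.
Context {R : realType} {V E : finType} (src tgt : E -> V) (c gam : E -> R).
Hypothesis gam_gt0 : forall e, 0 < gam e.
Context (A : {set E}) (u : V).

Local Notation stgt := (stgt tgt u).
Local Notation wcost := (wcost c gam).
Local Notation wgain := (wgain gam).
Local Notation swalk := (swalk src tgt A u).
Local Notation feasible := (feasible src tgt c gam A u).
Local Notation oracle := (oracle src tgt c gam A u).
Local Notation state := (@ndm_state R V).

Definition labelled (s : state) : Prop :=
  [/\ feasible (nd_lab s), nd_lab s None = Some (nd_delta s) &
      nd_lab s (Some u) = Some (nd_f s + nd_delta s)].

(** A certificate of optimality: feasible labels together with a walk of the same value, whose gain
    yields the supergradient. *)
Definition tight (s : state) (P : seq E) : Prop :=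
  [/\ labelled s, swalk (Some u) None P,
      nd_f s + nd_delta s = wcost P + wgain P * nd_delta s &
      nd_g s = wgain P - 1].

Definition newton (s : state) : R := nd_delta s - nd_f s / nd_g s.

Definition descending (s : state) : Prop := nd_f s < 0 /\ nd_g s < 0.

(** Concavity: the value of a fixed walk is affine in the sink label and bounds the label of [u]
    under all feasible labels. *)
Lemma tangent_line s P s' : tight s P -> labelled s' ->
  nd_f s' <= nd_f s + nd_g s * (nd_delta s' - nd_delta s).
Proof.
move=> [_ wP fE ->] [fe l0 lu].
have [q] := feasible_walk_Some gam_gt0 fe wP l0.
by rewrite lu => -[<-]; lra.
Qed.

Lemma newton_lt s : descending s -> newton s < nd_delta s.
Proof.
by case=> f0 g0; rewrite /newton ltrBlDr ltrDl ltr_ndivlMr// mul0r.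
Qed.

Lemma newton_tangent s : descending s -> nd_f s + nd_g s * (newton s - nd_delta s) = 0.
Proof.
by case=> _ g0; rewrite /newton addrAC subrr sub0r mulrN mulrC divfK ?subrr// lt_eqF.
Qed.

Section Oracle.
Context (base : @labels R V) (d0 a0 : R).
Hypothesis base_feasible : feasible base.
Hypothesis base_sink : base None = Some d0.
Hypothesis base_u : base (Some u) = Some a0.

(** A nonempty trace always reaches the sink. An empty one leaves [u] at its label [a0] and produces
    the default slope [-1]. *)
Lemma oracle_Some d f g lab : oracle base d (Some f) g lab ->
  labelled (NS d g f lab) /\
  ((f + d = a0 /\ g = -1) \/ exists2 P, tight (NS d g f lab) P & uniq P).
Proof.
case=> P [gv]; case: ifP => // /negbT/feasibleP fe [[a [la [->]]] ->] {f}.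
have ok e : e \in A -> stgt e != None -> arc_ok src tgt c gam u (upd base d) e.
  by move=> /base_feasible; rewrite /arc_ok /=; case: (stgt e).
have [l0 cases] := grapevine_trace gv erefl ok.
have lbl k : labelled (NS d k (a - d) lab) by split=> //=; rewrite la subrK.
split => //; case: cases => [[-> ua]|[Pn wP ua]].
  left; split => //; move: ua; rewrite /= la base_u => -[->]; exact: subrK.
right; exists P; last first.
  (* The final labels serve as their own certificate. *)
  have [_] := grapevine_converges gam_gt0 base_feasible base_sink fe l0 (lexx _) gv.
  exact: map_uniq.
rewrite (swalk_sink Pn wP); split => //=.
by move: ua; rewrite la => -[<-]; rewrite subrK.
Qed.

Lemma oracle_None d g lab s : oracle base d None g lab -> labelled s ->
  d < nd_delta s.
Proof.
case=> P [gv]; case: ifP => [vio _|_ [[a [_ //]]]] [fe l0 _].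
rewrite ltNge; apply/negP => ds.
have [/feasibleP] := grapevine_converges gam_gt0 base_feasible base_sink fe l0 ds gv.
by rewrite vio.
Qed.

Lemma step_labelled s s' : ndm_step src tgt c gam A u base s s' -> labelled s'.
Proof.
case=> -[fd|] [gd [ld [od //]]] [_ [[f'|] [g' [l' [o' ->]]]]].
  by case: ifP => _; [case: (oracle_Some o')|case: (oracle_Some od)].
by case: (oracle_Some od).
Qed.

(* When the look-ahead point is rejected, concavity confines all later iterates
   to its right. *)
Lemma step_cases s P s' : tight s P -> descending s -> newton s < a0 ->
  ndm_step src tgt c gam A u base s s' -> nd_f s' != 0 ->
  [/\ exists2 P', tight s' P' & uniq P', descending s', newton s' < a0 &
    nd_delta s' = 2 * newton s - nd_delta s \/
    nd_delta s' = newton s /\ forall t Q, tight t Q -> descending t ->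
      2 * newton s - nd_delta s <= nd_delta t].
Proof.
move=> ts ds na; have nlt := newton_lt ds.
(* An unchanged label at [u] means [f = a0 - d], which is positive for [d <= newton s < a0]. This
   excludes the default slope at every new iterate. *)
have used d f g lab : d <= newton s -> oracle base d (Some f) g lab -> f < 0 -> g < 0 ->
    [/\ exists2 P', tight (NS d g f lab) P' & uniq P', descending (NS d g f lab) &
        newton (NS d g f lab) < a0].
  move=> dn o f0 g0; have dsc : descending (NS d g f lab) by [].
  have [_ [[fd _]|//]] := oracle_Some o; first by move: fd dn na f0; lra.
  by split => //; have := newton_lt dsc => /=; move: dn na; lra.
case=> -[fd|] [gd [ld [od //]]]; rewrite -/(newton s) in od *.
move=> [noroot [f' [g' [l' [o' ->]]]]].
have dl : 2 * newton s - nd_delta s <= newton s by lra.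
have [lblN _] := oracle_Some od.
have fd0 : fd <= 0.
  by have := tangent_line ts lblN; rewrite /= newton_tangent.
have main : fd != 0 ->
    (forall t Q, tight t Q -> descending t -> 2 * newton s - nd_delta s <= nd_delta t) ->
    [/\ exists2 P', tight (NS (newton s) gd fd ld) P' & uniq P',
      descending (NS (newton s) gd fd ld), newton (NS (newton s) gd fd ld) < a0 &
      newton s = 2 * newton s - nd_delta s \/
      newton s = newton s /\ forall t Q, tight t Q -> descending t ->
      2 * newton s - nd_delta s <= nd_delta t].
  move=> fdn later; have fdlt : fd < 0 by rewrite lt_neqAle fdn.
  have gdlt : gd < 0 by rewrite ltNge; apply/negP => gd0; apply: noroot.
  have [? ? ?] := used _ _ _ _ (lexx _) od fdlt gdlt.
  by split => //; right.
case: f' o' => [f'|] o'; last first.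
  move=> fdn; apply: main => // t Q [lt _ _ _] _.
  exact/ltW/(oracle_None o' lt).
case: ifP => [/andP[f'0 g'0] _|rej].
  by have [? ? ?] := used _ _ _ _ dl o' f'0 g'0; split => //; left.
move=> fdn; apply: main => // t Q tt [ft gt].
have [lbl' cases] := oracle_Some o'.
(* A descending [t] left of the rejected point forces [f' < 0], so the rejection came from
   [0 <= g']. The tangents at [t] and at [d'] then contradict each other. *)
rewrite leNgt; apply/negP => lt.
have up := tangent_line tt lbl'; rewrite /= in up.
set d' := 2 * _ - _ in o' lbl' cases lt up dl.
have f'0 : f' < 0 by apply: le_lt_trans up _; nra.
have g'0 : 0 <= g' by rewrite leNgt; apply/negP => g'0; rewrite f'0 g'0 in rej.
case: cases => [[_ g'E]|[P' t' _]]; first by move: g'0; rewrite g'E oppr_ge0 ler10.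
have [lblt _ _ _] := tt.
have := tangent_line t' lblt => /= up'.
have : f' < f' by nra.
by rewrite ltxx.
Qed.

End Oracle.

(** * Reduced costs along the traced walks and the iteration count *)

Lemma sum_reduced_costs (Y : option V -> R) x y P : swalk x y P -> uniq P ->
  \sum_(e <- P) wgain (take (index e P) P) *
     (c e + gam e * Y (stgt e) - Y (Some (src e))) =
  wcost P + wgain P * Y y - Y x.
Proof.
elim: P x => [|e P IH] x /=; first by move=> /eqP-> _; rewrite big_nil wgain_nil; ring.
case/and3P => _ /eqP<- wP /andP[eP uP]; rewrite big_cons eqxx take0 wgain_nil.
(* As [e] does not recur in the tail, each prefix of the tail merely acquires the factor [gam e]. *)
rewrite (eq_big_seq (fun e' => gam e * (wgain (take (index e' P) P) *
     (c e' + gam e' * Y (stgt e') - Y (Some (src e')))))); last first.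
  move=> e' e'P; case: eqP => [ee|_]; first by rewrite ee e'P in eP.
  by rewrite wgain_cons mulrA.
by rewrite -mulr_sumr (IH _ wP uP) wgain_cons; ring.
Qed.

Lemma walk_split e x y P : e \in P -> swalk x y P ->
  let k := index e P in
  [/\ P = take k P ++ e :: drop k.+1 P, swalk x (Some (src e)) (take k P) &
      swalk (Some (src e)) y (e :: drop k.+1 P)].
Proof.
move=> eP wP k.
have PE : P = take k P ++ e :: drop k.+1 P by rewrite -drop_index// cat_take_drop.
move: wP; rewrite {1}PE => /swalk_cat[z w1 w2].
by have /and3P[_ /eqP zE _] := w2; rewrite -zE in w1 w2.
Qed.

(** The default 0 for infinite labels never matters: both ends of an arc on a walk to the sink have
    finite labels. *)
Lemma reduced_cost_ge0 lab d e x P : feasible lab -> lab None = Some d ->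
  swalk x None P -> e \in P ->
  0 <= c e + gam e * odflt 0 (lab (stgt e)) - odflt 0 (lab (Some (src e))).
Proof.
move=> fe l0 wP eP; have [_ _ w2] := walk_split eP wP.
have [q qE _] := feasible_walk_Some gam_gt0 fe w2 l0.
have /and3P[eA _ w3] := w2.
have [r rE _] := feasible_walk_Some gam_gt0 fe w3 l0.
by have := fe e eA; rewrite /arc_ok /ext_le qE rE /= -leNgt; lra.
Qed.

(* Exchange argument: both prefixes lead to the tail of e, whose label drops
   from s to s', so the prefix preferred at s' has the larger gain. *)
Lemma prefix_gain_le s s' P P' e : tight s P -> tight s' P' ->
  nd_delta s' < nd_delta s -> e \in P -> e \in P' ->
  wgain (take (index e P) P) <= wgain (take (index e P') P').
Proof.
move=> [[fe l0 lu] wP fP _] [[fe' l0' lu'] wP' fP' _] dd eP eP'.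
have [PE wR wQ] := walk_split eP wP.
have [PE' wR' wQ'] := walk_split eP' wP'.
move: (take (index e P) P) (take (index e P') P')
  (e :: drop (index e P).+1 P) (e :: drop (index e P').+1 P') PE PE' wR wR' wQ wQ'.
move=> T T' Q Q' PE PE' wT wT' wQ wQ'.
move: fP fP'; rewrite PE PE' !wcost_cat !wgain_cat => fP fP'.
have [r rE rle] := feasible_walk_Some gam_gt0 fe wQ l0.
have [r' rE' rle'] := feasible_walk_Some gam_gt0 fe' wQ l0'.
have [r2 rE2 rle2] := feasible_walk_Some gam_gt0 fe' wQ' l0'.
have [a1 aE1 ale1] := feasible_walk_Some gam_gt0 fe wT rE.
have [a2 aE2 ale2] := feasible_walk_Some gam_gt0 fe wT' rE.
have [a3 aE3 ale3] := feasible_walk_Some gam_gt0 fe' wT rE'.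
have [a4 aE4 ale4] := feasible_walk_Some gam_gt0 fe' wT' rE'.
move: rE2 aE1 aE2 aE3 aE4; rewrite rE' lu lu' => -[?] [?] [?] [?] [?].
subst r2 a1 a2 a3 a4.
have gT := wgain_gt0 gam_gt0 T; have gT' := wgain_gt0 gam_gt0 T'.
have gQ := wgain_gt0 gam_gt0 Q.
(* Tightness of the whole walk passes to its suffix. *)
have rq : r = wcost Q + wgain Q * nd_delta s.
  by apply/le_anti/andP; split => //; rewrite -(ler_pM2l gT); lra.
have rq' : r' = wcost Q' + wgain Q' * nd_delta s'.
  by apply/le_anti/andP; split => //; rewrite -(ler_pM2l gT'); lra.
have rr : r' < r by rewrite rq; apply: le_lt_trans rle' _; rewrite ltrD2l ltr_pM2l.
have e1 : nd_f s + nd_delta s = wcost T + wgain T * r by rewrite rq fP; ring.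
have e2 : nd_f s' + nd_delta s' = wcost T' + wgain T' * r' by rewrite rq' fP'; ring.
have rr0 : 0 < r - r' by rewrite subr_gt0.
(* Adding [ale2] and [ale3] cancels the prefix costs and leaves the gains times [r - r']. *)
rewrite -(ler_pM2r rr0); move: ale2 ale3; rewrite e1 e2; lra.
Qed.

Lemma iteration_count (M : nat) (s : nat -> state) (P : nat -> seq E) :
  (forall i, (i <= M)%N -> tight (s i) (P i) /\ descending (s i)) ->
  (forall i, (0 < i <= M)%N -> uniq (P i)) ->
  (forall i, (i < M)%N ->
     nd_delta (s i.+1) = 2 * newton (s i) - nd_delta (s i) \/
     nd_delta (s i.+1) = newton (s i) /\
       2 * newton (s i) - nd_delta (s i) <= nd_delta (s M)) ->
  (M <= 8 * #|A| + 2)%N.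
Proof.
move=> good uP step.
pose f i := nd_f (s i); pose g i := nd_g (s i); pose dl i := nd_delta (s i).
have f0 i : (i <= M)%N -> f i < 0 by move=> /good[_ []].
have g0 i : (i <= M)%N -> g i < 0 by move=> /good[_ []].
have tan i j : (i <= M)%N -> (j <= M)%N -> f i <= f j + g j * (dl i - dl j).
  by move=> /good[[li _ _ _] _] /good[tj _]; apply: tangent_line tj li.
(* The shift skips iterate 0, whose walk is not assumed duplicate-free; the bound [hge] requires two
   further iterates, whence [M - 2]. *)
pose h i := tangent_at_last M f g dl i.+1.
have hge i : (i < M - 2)%N -> - f M <= h i.
  by move=> iM; apply: (tangent_at_last_ge f0 g0 tan step); lia.
have fM := f0 _ (leqnn M).
pose Y x := odflt 0 (nd_lab (s M) x).
pose w i e := wgain (take (index e (P i.+1)) (P i.+1)) *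
  (c e + gam e * Y (stgt e) - Y (Some (src e))).
have [[[feM l0M luM] _ _ _] _] := good _ (leqnn M).
have rc0 i e : (i <= M)%N -> e \in P i ->
    0 <= c e + gam e * Y (stgt e) - Y (Some (src e)).
  by move=> /good[[_ wP _ _] _]; apply: reduced_cost_ge0 feM l0M wP.
suff : (M - 2 <= 8 * #|A|)%N by lia.
apply: (@geometric_counting R E A (M - 2) (fun i => P i.+1) w h).
- by move=> i /hge; lra.
- by move=> i iM; apply: (tangent_at_last_decr f0 g0 tan step); lia.
- by move=> i iM; apply: (tangent_at_last_halve f0 g0 tan step); lia.
- move=> i iM; have [|[_ wP _ _] _] := good i.+1; first by lia.
  exact: swalk_mem wP.
- move=> i e iM eP; apply: mulr_ge0; first exact/ltW/wgain_gt0.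
  by apply: rc0 eP; lia.
- move=> i iM; have [|[_ wP fE gE] _] := good i.+1; first by lia.
  have ui : uniq (P i.+1) by apply: uP; lia.
  (* The sum telescopes to [h i - f M]; the factor 2 comes from [0 < - f M <= h i]. *)
  rewrite -big_uniq//= (sum_reduced_costs Y wP ui) /Y l0M luM /=.
  have := hge _ iM; rewrite /h /tangent_at_last /f /g /dl gE; move: fM fE; rewrite /f.
  by move=> fM fE hi; apply/andP; split; lra.
- move=> i j e /andP[ij jM] ePi ePj.
  have [|ti _] := good i.+1; first by lia.
  have [|tj _] := good j.+1; first by lia.
  rewrite /w ler_wpM2r//; first by apply: rc0 ePi; lia.
  apply: prefix_gain_le ti tj _ ePi ePj.
  by apply: (iterates_decr f0 g0 step); lia.
Qed.

Lemma invoked_start (y : V -> ext) init :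
  (forall e, e \in A -> src e != u ->
     ext_le (y (src e)) (ext_aff (c e) (gam e) (y (tgt e)))) ->
  ndm_invoked src tgt c gam A u y init ->
  labelled init /\
  (nd_f init != 0 -> exists P,
     [/\ tight init P, descending init & newton init < nd_f init + nd_delta init]).
Proof.
move=> yok [d0 [a0 [P [yu gv /feasibleP fe gP [l0 lu fE gE]]]]].
have ok e : e \in A -> stgt e != None -> arc_ok src tgt c gam u (ybar u y d0) e.
  rewrite /arc_ok /Defs.stgt /=; case: (eqVneq (tgt e) u) => //= tu eA _.
  rewrite (negbTE tu); case: (eqVneq (src e) u) => [se|]; last exact: yok.
  (* If the minimum is infinite, so is the label of the head of [e], and any label of [u] is
     admissible. *)
  have := @ext_bigmin_le R E (fun e => (e \in A) && (src e == u))
     (fun e => ext_aff (c e) (gam e) (y (tgt e))) e.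
  rewrite eA se eqxx => /(_ isT); move: yu; rewrite /phase_yu.
  case: (\big[_/_]_(_ | _) _) => [b ->//|_].
  by case: (y (tgt e)).
have [l0' cases] := grapevine_trace gv erefl ok.
have dE : nd_delta init = d0 by move: l0'; rewrite l0 => -[].
have lbl : labelled init by split => //; rewrite lu fE subrK.
split => // fn0.
case: cases => [[_]|[Pn wP luP]].
  by rewrite lu /= eqxx => -[a0E]; rewrite fE dE a0E subrr eqxx in fn0.
have f0 : nd_f init < 0.
  rewrite lt_neqAle fn0 fE dE /=.
  by have := grapevine_le (Some u) gv; rewrite lu /= eqxx /ext_le /= -leNgt subr_le0.
have gP1 : wgain P < 1 by move: gP; rewrite Pn /= -ltNge.
have g0 : nd_g init < 0 by rewrite gE subr_lt0.
exists P; split => //.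
  split => //; rewrite fE subrK dE.
  by move: luP; rewrite lu => -[].
have ds : descending init by [].
have := newton_tangent ds; have := newton_lt ds.
(* Gains are positive, so the Newton step is longer than [- nd_f init] and ends below the label of
   [u]. *)
have : - 1 < nd_g init by rewrite gE; have := wgain_gt0 gam_gt0 P; lra.
by move: (newton init) => v; nra.
Qed.

End Iterations.

(** * Feasibility across phases and the final bound *)

Lemma bounded_choice (T : Type) (Q : nat -> T -> Prop) n :
  (forall i, (i <= n)%N -> exists x, Q i x) ->
  exists F, forall i, (i <= n)%N -> Q i (F i).
Proof.
elim: n => [|n IH] ex.
  have [x Qx] := ex 0 (leqnn 0); exists (fun=> x) => i.
  by rewrite leqn0 => /eqP->.
have [i /leqW /ex //|F FP] := IH; have [x Qx] := ex n.+1 (leqnn _).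
exists (fun i => if i == n.+1 then x else F i) => i.
by rewrite leq_eqVlt; case: eqP => [->|_ /= /FP].
Qed.

Lemma reach_feasible (R : realType) (V E : finType) (src tgt : E -> V)
    (c gam : E -> R) pre y : (forall e, 0 < gam e) -> reach src tgt c gam pre y ->
  forall e, e \in Eset src pre ->
    ext_le (y (src e)) (ext_aff (c e) (gam e) (y (tgt e))).
Proof.
move=> gam0; elim=> {pre y} [e|pre u y y' _ IH]; first by rewrite inE.
have yok e : e \in Eset src (rcons pre u) -> src e != u ->
    ext_le (y (src e)) (ext_aff (c e) (gam e) (y (tgt e))).
  by rewrite inE mem_rcons inE => /predU1P[->|ep _]; rewrite ?eqxx// IH// inE.
case=> [[yu y'E] e eA|[init [d [lab [inv [N [st [[st0 run] fN _ ->]]] y'E]]]] e eA].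
  rewrite !y'E; case: (eqVneq (src e) u) => [se|su].
    have := @ext_bigmin_le R E (fun e => (e \in Eset src (rcons pre u)) && (src e == u))
       (fun e => ext_aff (c e) (gam e) (y (tgt e))) e.
    rewrite eA se eqxx => /(_ isT); move: yu; rewrite /phase_yu.
    case: (\big[_/_]_(_ | _) _) => [b //|_].
    by case: ifP => //; case: (y (tgt e)).
  by case: ifP => _; [case: (y (src e))|apply: yok].
have [lbl0 _] := invoked_start gam0 yok inv.
have [fe l0 lu] : labelled src tgt c gam (Eset src (rcons pre u)) u (st N).
  case: N run {fN y'E} => [|N] run; first by rewrite st0.
  have [feb b0 bu] := lbl0.
  exact: (step_labelled gam0 feb b0 bu (run N (ltnSn N)).2).
(* At a root the labels of [u] and of the sink agree, so merging the two nodes preserves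
   feasibility. *)
have := fe e eA; rewrite !y'E /arc_ok /stgt; case: eqP => // ->.
by rewrite l0 lu fN add0r.
Qed.

(* There is an absolute constant C such that, for every M2VPI system, every
   processing order, every execution of Algorithm 3, and every phase k (node u
   processed after the nodes pre) in which the look-ahead Newton-Dinkelbach
   method is invoked, that method performs at most C * |E(G^(k))| iterations. *)
Theorem theorem4p11 :
  exists C : nat,
  forall (R : realType) (V E : finType) (src tgt : E -> V) (c gam : E -> R),
  (forall e, 0 < gam e) ->
  forall (ord pre rest : seq V) (u : V) (y : V -> ext) (init : ndm_state),
  perm_eq ord (enum V) ->
  ord = pre ++ u :: rest ->
  reach src tgt c gam pre y ->
  ndm_invoked src tgt c gam (Eset src (rcons pre u)) u y init ->
  forall (N : nat) (st : nat -> ndm_state),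
  ndm_run src tgt c gam (Eset src (rcons pre u)) u (nd_lab init) init N st ->
  (N <= C * #|Eset src (rcons pre u)|)%N.
Proof.
(* With [N = M + 1] and [M <= 8 * #|A| + 2], the additive 3 is absorbed because [A] contains an arc
   of the first walk. *)
exists 11 => R V E src tgt c gam gam0 _ pre _ u y init _ _ reach_y inv N st.
set A := Eset src (rcons pre u) in inv * => -[st0 run].
case: N run => // M run.
have yok e : e \in A -> src e != u ->
    ext_le (y (src e)) (ext_aff (c e) (gam e) (y (tgt e))).
  rewrite inE mem_rcons inE => /predU1P[->|ep _]; first by rewrite eqxx.
  by apply: reach_feasible reach_y _ _; rewrite ?inE.
have [[feb b0 bu] start] := invoked_start gam0 yok inv.
set a0 := nd_f init + nd_delta init in bu start.
have good i : (i <= M)%N -> exists P,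
    [/\ tight src tgt c gam A u (st i) P, descending (st i), newton (st i) < a0 &
        (0 < i)%N -> uniq P].
  elim: i => [|i IH] iM.
    rewrite st0; have [|P [? ? ?]] := start; last by exists P.
    by rewrite -st0; have [] := run 0 isT.
  have [P [tP ds na _]] := IH (ltnW iM).
  have [_ stp] := run i (leqW iM); have [fn0 _] := run i.+1 iM.
  have [[P' ? ?] ? ? _] := step_cases gam0 feb b0 bu tP ds na stp fn0.
  by exists P'.
have [P goodP] := bounded_choice good.
have A0 : (0 < #|A|)%N.
  have [[_ wP _ _] _ _ _] := goodP 0 (leq0n M).
  by case: (P 0) wP => //= e Q /andP[eA _]; apply/card_gt0P; exists e.
suff : (M <= 8 * #|A| + 2)%N by lia.
apply: (@iteration_count R V E src tgt c gam gam0 A u M st P).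
- by move=> i /goodP[].
- by move=> i /andP[i0 /goodP[_ _ _]]; apply.
- move=> i iM; have [tP ds na _] := goodP i (ltnW iM).
  have [_ stp] := run i (leqW iM); have [fn0 _] := run i.+1 iM.
  have [_ _ _ []] := step_cases gam0 feb b0 bu tP ds na stp fn0; first by left.
  move=> [-> later]; right; split => //.
  have [tM dM _ _] := goodP M (leqnn M); exact: later tM dM.
Qed.
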